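(* Let $G$ be a finite group, $K\le G$ a subgroup, and suppose that $(\sigma,W)$ is an irreducible representation of $G$ and $(\theta,V)$ an irreducible representation of $K$, of dimensions $d_\sigma$ and $d_\theta$. Let $m=\dim\mathrm{Hom}_G(W,\mathrm{Ind}_K^GV)$ and let $L_1,\ldots,L_m\in\mathrm{Hom}_K(V,\mathrm{Res}^G_KW)$. Then $\sqrt{\frac{d_\sigma}{d_\theta}}(L_1^* )^\vee,\sqrt{\frac{d_\sigma}{d_\theta}}(L_2^* )^\vee,\ldots,\sqrt{\frac{d_\sigma}{d_\theta}}(L_m^* )^\vee$ give rise to an isometric orthogonal decomposition of the $W$-component of $\mathrm{Ind}_K^GV$ if and only if $L_1,L_2,\ldots,L_m$ give rise to an isometric orthogonal decomposition of the $V$-component of $\mathrm{Res}^G_KW$.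
   Context: All vector spaces are finite-dimensional complex vector spaces with a Hermitian scalar product (linear in the first argument); all representations of finite groups are unitary. $T^*$ denotes the adjoint of $T$. $\mathrm{Hom}_G(A,B)$ (resp. $\mathrm{Hom}_K$) is the space of linear maps intertwining the $G$- (resp. $K$-) actions. Isometric orthogonal decomposition: if $\Gamma$ is a finite group, $A$ an irreducible $\Gamma$-representation, $B$ a $\Gamma$-representation and $m=\dim\mathrm{Hom}_\Gamma(A,B)$, then $T_1,\ldots,T_m\in\mathrm{Hom}_\Gamma(A,B)$ give rise to an isometric orthogonal decomposition of the $A$-(isotypic) component of $B$ if $\langle T_ia_1,T_ja_2\rangle_B=\langle a_1,a_2\rangle_A\,\delta_{i,j}$ for all $a_1,a_2\in A$ and all $i,j$. (Here $\Gamma=G$ or $\Gamma=K$; by Frobenius reciprocity $\dim\mathrm{Hom}_K(V,\mathrm{Res}^G_KW)=m$.) Induced representation: $\mathrm{Ind}_K^GV=\{f:G\to V: f(gk)=\theta(k^{-1})f(g)\ \forall g\in G,k\in K\}$ with $G$-action $[\lambda(g_0)f](g)=f(g_0^{-1}g)$ and scalar product $\langle f_1,f_2\rangle=\frac1{|K|}\sum_{g\in G}\langle f_1(g),f_2(g)\rangle_V$. For $L\in\mathrm{Hom}_K(\mathrm{Res}^G_KW,V)$, $L^\vee\in\mathrm{Hom}_G(W,\mathrm{Ind}_K^GV)$ is defined by $[L^\vee w](g)=\frac{1}{\sqrt{|G/K|}}L\sigma(g^{-1})w$ for $w\in W$, $g\in G$. *)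

(* Defs.v *)
From HB Require Import structures.
From mathcomp Require Import all_boot all_order all_fingroup all_algebra.
From mathcomp Require Import sesquilinear complex.
From mathcomp Require Import boolp reals.

Set Implicit Arguments.
Unset Strict Implicit.
Unset Printing Implicit Defensive.

Import Order.TTheory GRing.Theory Num.Theory Num.Def.
Local Open Scope ring_scope.

(* The complex numbers are the instance C := R[i], R : realType, of the       *)
(* numClosedFieldType C below.                                                *)

(* {dot V for conjC} is positive definite and linear in its first argument.   *)
Section Adjoint.
Variable C : numClosedFieldType.

Lemma riesz (U : vectType C) (f : {dot U for conjC}) (phi : 'Hom(U, C^o)) :
  exists v, forall u, phi u = f u v.
Proof.
have [phi0|] := eqVneq phi 0.
  by exists 0 => u; rewrite phi0 lfunE linear0r.
move=> phiN0.
have [w phiw] : exists w, phi w != 0.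
  have /lfunPn[w] := phiN0; rewrite zero_lfunE => wP; by exists w.
have [X XS [Y [wXY _ oY]]] := orthogonal_split f (vbasis (lker phi)) w.
move: XS; rewrite (span_basis (vbasisP _)) memv_ker => /eqP X0.
have phiY : phi Y != 0 by move: phiw; rewrite wXY linearD /= X0 add0r.
have Y0 : Y != 0 by apply: contraNneq phiY => ->; rewrite linear0.
have oYk u : phi u = 0 -> f u Y = 0.
  move=> /eqP; rewrite -memv_ker => uk.
  apply: (span_orthogonal (S1 := vbasis (lker phi)) (S2 := [:: Y])).
  - by rewrite orthogonal_sym.
  - by rewrite (span_basis (vbasisP _)).
  - by rewrite memv_span1.
exists ((phi Y / f Y Y)^* *: Y) => u.
have fY : f Y Y != 0 by rewrite dnorm_eq0.
have : f (u - (phi u / phi Y) *: Y) Y = 0.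
  by apply: oYk; rewrite linearB linearZ /= /GRing.scale /= divfK ?subrr.
rewrite linearBl linearZl_LR /= => /eqP; rewrite subr_eq0 => /eqP fuY.
rewrite linearZr_LR /= conjCK fuY.
by rewrite [X in _ * X]mulrC mulrA divfK // mulrC divfK.
Qed.

Lemma adjoint_exists (U V : vectType C) (f : {dot U for conjC})
    (h : {dot V for conjC}) (T : 'Hom(U, V)) :
  exists S : 'Hom(V, U), forall u v, h (T u) v = f u (S v).
Proof.
have ex v : exists s, forall u, h (T u) v = f u s.
  have lP : linear (fun u => h (T u) v : C^o).
    by move=> a x y; rewrite linearP linearPl.
  pose phi := GRing.isLinear.Build _ _ _ _ _ lP.
  pose L : {linear U -> C^o} := HB.pack (fun u => h (T u) v : C^o) phi.
  have [s sP] := riesz f (linfun L).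
  by exists s => u; rewrite -sP lfunE.
pose s v := sval (cid (ex v)).
have sP u v : h (T u) v = f u (s v) by rewrite /s; case: cid.
have inj x y : (forall u, f u x = f u y) -> x = y.
  move=> e; apply/eqP; rewrite -subr_eq0 -(dnorm_eq0 f).
  by rewrite linearBr /= e subrr.
have lS : linear s.
  move=> a x y; apply: inj => u.
  by rewrite -sP !linearDr /= !linearZr_LR /= !sP.
pose S : {linear V -> U} := HB.pack s (GRing.isLinear.Build _ _ _ _ _ lS).
by exists (linfun S) => u v; rewrite lfunE sP.
Qed.

End Adjoint.

Section UnitaryRepresentations.
Variable C : numClosedFieldType.

(* As for mx_representation, the values of rep_act outside G are irrelevant.  *)
Record unitary_rep (gT : finGroupType) (G : {group gT}) := UnitaryRep {
  rep_space :> vectType C;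
  rep_dot : {dot rep_space for conjC};
  rep_act : gT -> 'End(rep_space);
  rep_act1 : rep_act 1%g = \1%VF;
  rep_actM : {in G &, forall x y,
    rep_act (x * y)%g = (rep_act x \o rep_act y)%VF};
  rep_unitary : {in G, forall x u v,
    rep_dot (rep_act x u) (rep_act x v) = rep_dot u v}
}.

Section OneGroup.
Variables (gT : finGroupType) (G : {group gT}).
Implicit Types A B : unitary_rep G.

Definition irreducible_rep A : Prop :=
  (0 < \dim {: A})%N /\
  forall U : {vspace A}, {in G, forall g, (rep_act A g @: U <= U)%VS} ->
    U = 0%VS \/ U = {: A}%VS.

Definition intertwining_defect A B (g : gT) (T : 'Hom(A, B)) : 'Hom(A, B) :=
  (T \o rep_act A g)%VF - (rep_act B g \o T)%VF.

Fact intertwining_defect_linear A B g : linear (@intertwining_defect A B g).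
Proof.
move=> a S T; rewrite /intertwining_defect; apply/lfunP => u.
by rewrite !lfun_simp linearP scalerBr opprD addrACA.
Qed.

HB.instance Definition _ A B g :=
  GRing.isLinear.Build _ _ _ _ _ (@intertwining_defect_linear A B g).

(* Hom_G(A, B) as a subspace of 'Hom(A, B); see Hom_repP.                     *)
Definition Hom_rep A B : {vspace 'Hom(A, B)} :=
  (\bigcap_(g in G) lker (linfun (@intertwining_defect A B g)))%VS.

Lemma Hom_repP A B (T : 'Hom(A, B)) :
  reflect {in G, forall g u, T (rep_act A g u) = rep_act B g (T u)}
          (T \in Hom_rep A B).
Proof.
rewrite /Hom_rep memvE; apply: (iffP subv_bigcapP) => [h g gG u | h g gG].
  move: (h g gG); rewrite -memvE memv_ker lfunE /= subr_eq0 => /eqP/lfunP/(_ u).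
  by rewrite !lfun_simp.
rewrite -memvE memv_ker lfunE /= subr_eq0; apply/eqP/lfunP => u.
by rewrite !lfun_simp h.
Qed.

Definition adjoint A B (T : 'Hom(A, B)) : 'Hom(B, A) :=
  sval (cid (adjoint_exists (rep_dot A) (rep_dot B) T)).

Lemma adjointP A B (T : 'Hom(A, B)) u v :
  rep_dot B (T u) v = rep_dot A u (adjoint T v).
Proof. by rewrite /adjoint; case: cid. Qed.

Definition isometric_orthogonal_decomposition A B m
    (T : 'I_m -> 'Hom(A, B)) : Prop :=
  [/\ m = \dim (Hom_rep A B),
      forall i, T i \in Hom_rep A B
    & forall i j (a1 a2 : A),
        rep_dot B (T i a1) (T j a2) = rep_dot A a1 a2 * (i == j)%:R].

End OneGroup.

Section Restriction.
Variables (gT : finGroupType) (G K : {group gT}) (sKG : K \subset G).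
Variable W : unitary_rep G.

Definition Res : unitary_rep K :=
  @UnitaryRep gT K W (rep_dot W) (rep_act W) (rep_act1 W)
    (sub_in2 (subsetP sKG) (@rep_actM _ _ W))
    (sub_in1 (subsetP sKG) (@rep_unitary _ _ W)).

End Restriction.

(* The ambient group G of the induction is the whole finGroupType gT.         *)
Section Induction.
Variables (gT : finGroupType) (K : {group gT}) (V : unitary_rep K).

Definition equivariance_defect (g k : gT) (f : {ffun gT -> V}) : V :=
  f (g * k)%g - rep_act V k^-1%g (f g).

Fact equivariance_defect_linear g k : linear (equivariance_defect g k).
Proof.
move=> a f1 f2; rewrite /equivariance_defect !ffunE linearP.
by rewrite scalerBr opprD addrACA.
Qed.

HB.instance Definition _ g k :=
  GRing.isLinear.Build _ _ _ _ _ (equivariance_defect_linear g k).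

Definition ind_space : {vspace {ffun gT -> V}} :=
  (\bigcap_g \bigcap_(k in K) lker (linfun (equivariance_defect g k)))%VS.

Lemma ind_spaceP (f : {ffun gT -> V}) :
  reflect (forall g k, k \in K -> f (g * k)%g = rep_act V k^-1%g (f g))
          (f \in ind_space).
Proof.
rewrite /ind_space memvE; apply: (iffP subv_bigcapP) => [h g k kK | h g _].
  move: (h g isT) => /subv_bigcapP/(_ k kK).
  by rewrite -memvE memv_ker lfunE /= subr_eq0 => /eqP.
apply/subv_bigcapP => k kK.
by rewrite -memvE memv_ker lfunE /= subr_eq0 h.
Qed.

Definition ind_dot (f1 f2 : subvs_of ind_space) : C :=
  #|K|%:R^-1 * \sum_(g : gT) rep_dot V (vsval f1 g) (vsval f2 g).

Fact ind_dot_bilinear :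
  bilinear_for ( *%R : GRing.Scale.law C C) (conjC \; *%R) ind_dot.
Proof.
split=> [f2 a f f' | f1 a f f']; rewrite /ind_dot /=.
  rewrite mulrCA -mulrDr; congr (_ * _); rewrite mulr_sumr -big_split /=.
  by apply: eq_bigr => g _; rewrite !ffunE linearPl.
rewrite mulrCA -mulrDr; congr (_ * _); rewrite mulr_sumr -big_split /=.
by apply: eq_bigr => g _; rewrite !ffunE linearDr linearZr_LR.
Qed.

HB.instance Definition _ :=
  bilinear_isBilinear.Build _ _ _ _ _ _ ind_dot ind_dot_bilinear.

Fact ind_dot_hermitian f1 f2 :
  ind_dot f1 f2 = (-1) ^+ false * conjC (ind_dot f2 f1).
Proof.
rewrite /ind_dot expr0 mul1r rmorphM fmorphV rmorph_nat rmorph_sum /=.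
by congr (_ * _); apply: eq_bigr => g _; rewrite hermC expr0 mul1r.
Qed.

HB.instance Definition _ :=
  isHermitianSesquilinear.Build _ _ _ _ ind_dot ind_dot_hermitian.

Fact ind_dot_pos f : f != 0 -> 0 < ind_dot f f.
Proof.
move=> f0; rewrite /ind_dot mulr_gt0 ?invr_gt0 ?ltr0n ?cardG_gt0 //.
rewrite lt_def sumr_ge0 ?andbT => [|g _]; last exact: dnorm_ge0.
apply: contraNneq f0 => /eqP; rewrite psumr_eq0 => [/allP h|g _]; last exact: dnorm_ge0.
apply/eqP/val_inj/ffunP => g; rewrite ffunE; apply/eqP.
by rewrite -(dnorm_eq0 (rep_dot V)); apply: (h g); rewrite mem_index_enum.
Qed.

HB.instance Definition _ := isDotProduct.Build _ _ ind_dot ind_dot_pos.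

Definition translate (g0 : gT) (f : {ffun gT -> V}) : {ffun gT -> V} :=
  [ffun g => f (g0^-1 * g)%g].

Fact translate_linear g0 : linear (translate g0).
Proof. by move=> a f1 f2; apply/ffunP => g; rewrite !ffunE. Qed.

HB.instance Definition _ g0 :=
  GRing.isLinear.Build _ _ _ _ _ (translate_linear g0).

Lemma translate_ind g0 f : f \in ind_space -> translate g0 f \in ind_space.
Proof.
by move=> /ind_spaceP h; apply/ind_spaceP => g k kK; rewrite !ffunE mulgA h.
Qed.

(* vsproj acts as the identity here, by translate_ind; see ind_actE.          *)
Definition ind_act (g0 : gT) : 'End(subvs_of ind_space) :=
  linfun (vsproj ind_space \o translate g0 \o vsval).

Lemma ind_actE g0 f g : vsval (ind_act g0 f) g = vsval f (g0^-1 * g)%g.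
Proof. by rewrite lfunE /= vsprojK ?translate_ind ?subvsP // ffunE. Qed.

Fact ind_act1 : ind_act 1%g = \1%VF.
Proof.
apply/lfunP => f; apply/val_inj/ffunP => g.
by rewrite /= ind_actE invg1 mul1g id_lfunE.
Qed.

Fact ind_actM : {in [set: gT] &, forall x y,
  ind_act (x * y)%g = (ind_act x \o ind_act y)%VF}.
Proof.
move=> x y _ _; apply/lfunP => f; apply/val_inj/ffunP => g.
by rewrite /= comp_lfunE !ind_actE invMg mulgA.
Qed.

Fact ind_unitary : {in [set: gT], forall x u v,
  ind_dot (ind_act x u) (ind_act x v) = ind_dot u v}.
Proof.
move=> x _ u v; rewrite /ind_dot; congr (_ * _).
rewrite [RHS](reindex_inj (mulgI x^-1%g)) /=.
by apply: eq_bigr => g _; rewrite !ind_actE.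
Qed.

Definition Ind : unitary_rep [set: gT] :=
  @UnitaryRep gT [set: gT]%G (subvs_of ind_space) ind_dot ind_act
    ind_act1 ind_actM ind_unitary.

Variable W : unitary_rep [set: gT].

Definition vee_fun (L : 'Hom(W, V)) (w : W) : {ffun gT -> V} :=
  [ffun g => (sqrtC #|[set: gT] : K|%g%:R)^-1 *: L (rep_act W g^-1%g w)].

Fact vee_fun_linear L : linear (vee_fun L).
Proof.
move=> a w1 w2; apply/ffunP => g; rewrite !ffunE.
by rewrite (linearP (rep_act W _)) (linearP L) scalerDr !scalerA mulrC.
Qed.

HB.instance Definition _ L :=
  GRing.isLinear.Build _ _ _ _ _ (vee_fun_linear L).

(* For L in Hom_K(Res W, V) the projection vsproj acts as the identity, and   *)
(* this is the map w |-> vee_fun L w: see veeE. Other L are irrelevant.       *)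
Definition vee (L : 'Hom(W, V)) : 'Hom(W, Ind) :=
  linfun (vsproj ind_space \o vee_fun L).

Lemma veeE (L : 'Hom(W, V)) w g : L \in Hom_rep (Res (subsetT K) W) V ->
  vsval (vee L w : subvs_of ind_space) g =
  (sqrtC #|[set: gT] : K|%g%:R)^-1 *: L (rep_act W g^-1%g w).
Proof.
move=> /Hom_repP hL; rewrite lfunE /= vsprojK ?ffunE //.
apply/ind_spaceP => x k kK; rewrite !ffunE linearZ /=; congr (_ *: _).
by rewrite invMg rep_actM ?inE // comp_lfunE hL ?groupV.
Qed.

End Induction.
End UnitaryRepresentations.

Arguments Hom_rep {C gT G} A B.

(* Main.v *)
(* For L, M in Hom_K(V, Res W), Schur's lemma on V gives L^* M = mu 1. The    *)
(* product of vee (L^* ) w1 and vee (M^* ) w2 is the average over G of        *)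
(* <M L^* sigma(g) w1, sigma(g) w2>, so by Schur's lemma on W it equals       *)
(* tr(M L^* ) / d_sigma <w1, w2> = (d_theta / d_sigma) mu <w1, w2>, because   *)
(* tr(M L^* ) = tr(L^* M). Hence, after rescaling, the Gram constants of both *)
(* families agree up to conjugation.                                          *)

Require Import Defs.
From HB Require Import structures.
From mathcomp Require Import all_boot all_order all_fingroup all_algebra.
From mathcomp Require Import sesquilinear spectral complex boolp reals.

Set Implicit Arguments.
Unset Strict Implicit.
Unset Printing Implicit Defensive.

Import Order.TTheory GRing.Theory Num.Theory Num.Def.
Import passmx.
Local Open Scope ring_scope.

(** Both orthogonality conditions are read off one matrix of scalars. Schur's lemma on [V] gives
    L_i^* L_j = mu_ij 1, so <L_i v1, L_j v2> is conj(mu_ij) <v1, v2>. The average of M L^* over G is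
    a scalar on [W] with the same trace, so the vees have Gram constants (d_theta / d_sigma) mu_ij
    ([vee_adjoint_dot]), and the factor sqrt(d_sigma / d_theta) turns these into mu_ij. As the
    Kronecker delta is real, either family is orthonormal exactly when mu_ij is the delta. The
    required number of maps is the same on both sides by Frobenius reciprocity combined with
    adjunction ([dim_Hom_rep_Ind]). *)

Section LinearFunctions.
Variable C : numClosedFieldType.

Definition lftrace (U : vectType C) (T : 'End(U)) : C :=
  \tr (mxof (vbasis {:U}) (vbasis {:U}) T).

Lemma lftraceZ (U : vectType C) a (T : 'End(U)) :
  lftrace (a *: T) = a * lftrace T.
Proof. by rewrite /lftrace linearZ mxtraceZ. Qed.

Lemma lftrace_sum (U : vectType C) (I : finType) (P : pred I)
    (T : I -> 'End(U)) :
  lftrace (\sum_(i | P i) T i) = \sum_(i | P i) lftrace (T i).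
Proof. by rewrite /lftrace linear_sum raddf_sum. Qed.

Lemma lftrace_id (U : vectType C) : lftrace (\1%VF : 'End(U)) = (\dim {:U})%:R.
Proof.
by rewrite /lftrace mxof1 ?mxtrace1 // (basis_free (vbasisP _)).
Qed.

Lemma lftrace_comp (U V : vectType C) (S : 'Hom(U, V)) (T : 'Hom(V, U)) :
  lftrace (S \o T)%VF = lftrace (T \o S)%VF.
Proof.
rewrite /lftrace (mxof_comp _ _ (vbasisP {:U})).
by rewrite (mxof_comp _ _ (vbasisP {:V})) mxtrace_mulC.
Qed.

Lemma leigenvalue_closed (U : vectType C) (T : 'End(U)) :
  (0 < \dim {:U})%N -> exists a, leigenvalue T a.
Proof.
move=> U0; have e := vbasisP {:U}.
have [a /eigenvalueP[v vT v0]] :=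
  eigenvalue_closed (mxof (vbasis {:U}) (vbasis {:U}) T) U0.
exists a; apply/negP => /eqP k0.
have : vecof (vbasis {:U}) v \in leigenspace T a.
  rewrite memv_ker !lfun_simp (hom_vecof _ e) vT linearZ /=.
  by rewrite subrr.
by rewrite k0 memv0 vecof_eq0 // (negPf v0).
Qed.

(** Taking adjoints is only conjugate-linear, so dimensions of Hom spaces are compared through the
    image of a basis. *)
Lemma conj_linear_dim_leq (A B : vectType C) (U : {vspace A}) (V : {vspace B})
    (phi : A -> B) :
  (forall a x y, phi (a *: x + y) = a^* *: phi x + phi y) ->
  {in U, forall x, phi x \in V} -> {in U, forall x, phi x = 0 -> x = 0} ->
  (\dim U <= \dim V)%N.
Proof.
move=> phiP phiV phi_inj.
have phi0 : phi 0 = 0.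
  by have := phiP (-1) 0 0; rewrite scaler0 addr0 rmorphN1 scaleN1r addNr.
have phi_sum n (k : 'I_n -> C) (x : 'I_n -> A) :
    phi (\sum_i (k i)^* *: x i) = \sum_i k i *: phi (x i).
  elim/big_rec2: _ => [//|i y1 y2 _ <-].
  by rewrite phiP conjCK.
have XV : (<<map_tuple phi (vbasis U)>> <= V)%VS.
  by apply/span_subvP => _ /mapP[x xU ->]; apply/phiV/vbasis_mem.
rewrite -(size_tuple (map_tuple phi (vbasis U))).
suff /eqP <- : free (map_tuple phi (vbasis U)) by apply: dimvS.
apply/freeP => k k0 i; apply/eqP; rewrite -conjC_eq0; apply/eqP; move: i.
have /freeP Ufree := basis_free (vbasisP U).
(* A relation with coefficients [k i] among the images is the image of the combination of basis
   vectors with conjugate coefficients. *)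
apply: (Ufree (fun i => (k i)^*)).
apply: phi_inj.
  apply: rpred_sum => i _; apply/rpredZ/vbasis_mem/mem_nth.
  by rewrite size_tuple.
rewrite phi_sum -[RHS]k0; apply: eq_bigr => i _.
by rewrite (nth_map 0) // size_tuple.
Qed.

End LinearFunctions.

Section Representations.
Variable C : numClosedFieldType.

(** * Adjoints, Schur's lemma and averaging over the group *)

Section Adjoint.
Variables (gT : finGroupType) (G : {group gT}).
Implicit Types A B D : unitary_rep C G.

Lemma rep_dot_injr A (x y : A) :
  (forall u, rep_dot A u x = rep_dot A u y) -> x = y.
Proof.
move=> e; apply/eqP; rewrite -subr_eq0 -(dnorm_eq0 (rep_dot A)).
by rewrite linearBr /= e subrr.
Qed.

Lemma rep_dot_injl A (x y : A) :
  (forall u, rep_dot A x u = rep_dot A y u) -> x = y.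
Proof.
move=> e; apply: rep_dot_injr => u.
by rewrite [LHS]hermC [RHS]hermC /= e.
Qed.

Lemma adjoint_conj_linear A B a (S T : 'Hom(A, B)) :
  adjoint (a *: S + T) = a^* *: adjoint S + adjoint T.
Proof.
apply/lfunP => v; apply: rep_dot_injr => u.
rewrite -adjointP !lfun_simp linearPl linearDr linearZr_LR /=.
by rewrite -!adjointP conjCK.
Qed.

Lemma adjoint_eq0 A B (T : 'Hom(A, B)) : adjoint T = 0 -> T = 0.
Proof.
move=> T0; apply/lfunP => u; apply: rep_dot_injl => v.
by rewrite adjointP T0 !lfunE /= linear0r linear0l.
Qed.

Lemma rep_unitary_adj A g (u v : A) : g \in G ->
  rep_dot A (rep_act A g u) v = rep_dot A u (rep_act A g^-1%g v).
Proof.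
move=> gG; rewrite -[RHS](rep_unitary gG) -comp_lfunE -rep_actM ?groupV //.
by rewrite mulgV rep_act1 id_lfunE.
Qed.

Lemma adjoint_Hom_rep A B (T : 'Hom(A, B)) :
  T \in Hom_rep A B -> adjoint T \in Hom_rep B A.
Proof.
move=> /Hom_repP hT; apply/Hom_repP => g gG v; apply: rep_dot_injr => u.
rewrite -adjointP -[g]invgK -!rep_unitary_adj ?groupV //.
by rewrite -adjointP hT ?groupV.
Qed.

Lemma comp_Hom_rep A B D (S : 'Hom(B, D)) (T : 'Hom(A, B)) :
  S \in Hom_rep B D -> T \in Hom_rep A B -> (S \o T)%VF \in Hom_rep A D.
Proof.
move=> /Hom_repP hS /Hom_repP hT; apply/Hom_repP => g gG u.
by rewrite !comp_lfunE hT ?hS.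
Qed.

Lemma rep_dot_scale_inj A x y : (0 < \dim {: A})%N ->
  (forall u v, x * rep_dot A u v = y * rep_dot A u v) -> x = y.
Proof.
rewrite lt0n dimv_eq0 => A0 exy.
have := exy (vpick {: A}) (vpick {: A}).
by apply/mulIf; rewrite dnorm_eq0 vpick0.
Qed.

(** An eigenspace of an intertwiner is invariant and nonzero, hence the whole space. *)
Lemma schur A (T : 'End(A)) : irreducible_rep A -> T \in Hom_rep A A ->
  exists a, T = a *: \1%VF.
Proof.
move=> [A0 irrA] /Hom_repP hT.
have [a Ta] := leigenvalue_closed T A0; exists a.
have [g gG|E0|Efull] := irrA (leigenspace T a).
- apply/subvP => _ /memv_imgP[u uE ->]; move: uE.
  rewrite !memv_ker !lfun_simp !subr_eq0 hT // => /eqP ->.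
  by rewrite linearZ.
- by rewrite /leigenvalue E0 eqxx in Ta.
apply/lfunP => u; have : u \in leigenspace T a by rewrite Efull memvf.
by rewrite memv_ker !lfun_simp subr_eq0 => /eqP.
Qed.

Definition average A (S : 'End(A)) : 'End(A) :=
  #|G|%:R^-1 *: \sum_(g in G) (rep_act A g^-1%g \o (S \o rep_act A g))%VF.

Lemma average_Hom_rep A (S : 'End(A)) : average S \in Hom_rep A A.
Proof.
apply/Hom_repP => h hG u; rewrite !scale_lfunE linearZ /=; congr (_ *: _).
(* Replacing g by g h^-1 brings the action of h out on the left and cancels it on the right. *)
rewrite !sum_lfunE linear_sum /= (reindex_inj (mulIg h^-1%g)) /=.
apply: eq_big => [g|g]; rewrite groupMr ?groupV // => gG.
rewrite invMg invgK !rep_actM ?groupV // !comp_lfunE.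
rewrite -[rep_act A h^-1%g _]comp_lfunE -rep_actM ?groupV //.
by rewrite mulVg rep_act1 id_lfunE.
Qed.

Lemma lftrace_average A (S : 'End(A)) : lftrace (average S) = lftrace S.
Proof.
rewrite /average lftraceZ lftrace_sum (eq_bigr (fun=> lftrace S)).
  by rewrite sumr_const -[lftrace S *+ _]mulr_natl mulKf // pnatr_eq0 -lt0n cardG_gt0.
move=> g gG; rewrite lftrace_comp -comp_lfunA -rep_actM ?groupV // mulgV.
by rewrite rep_act1 comp_lfun1r.
Qed.

(** By unitarity the left side is <[average S] u, v>; the average is a scalar, fixed by its
    trace. *)
Lemma sum_rep_dot_schur A (S : 'End(A)) u v : irreducible_rep A ->
  #|G|%:R^-1 * \sum_(g in G) rep_dot A (S (rep_act A g u)) (rep_act A g v) =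
  lftrace S / (\dim {: A})%:R * rep_dot A u v.
Proof.
move=> irrA; have [a Sa] := schur irrA (average_Hom_rep S).
have -> : lftrace S / (\dim {: A})%:R = a.
  rewrite -lftrace_average Sa lftraceZ lftrace_id mulfK //.
  by rewrite pnatr_eq0 -lt0n; case: irrA.
have : rep_dot A (average S u) v = a * rep_dot A u v.
  by rewrite Sa !lfun_simp linearZl_LR.
rewrite /average scale_lfunE linearZl_LR /= sum_lfunE linear_sumlz /= => <-.
congr (_ * _); apply: eq_bigr => g gG.
by rewrite !lfun_simp /= rep_unitary_adj ?groupV // invgK.
Qed.

End Adjoint.

(** * Frobenius reciprocity and inner products of vees *)

Section Frobenius.
Variables (gT : finGroupType) (K : {group gT}).
Variables (V : unitary_rep C K) (W : unitary_rep C [set: gT]).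
Local Notation ResW := (Res (subsetT K) W).

Lemma vee_linear : linear (@vee C gT K V W).
Proof.
move=> a P Q; apply/lfunP => w; rewrite !lfun_simp /= -linearP /=.
congr (vsproj _ _); apply/ffunP => g; rewrite !ffunE !lfun_simp.
by rewrite scalerDr !scalerA mulrC.
Qed.

Lemma vee_Hom_rep (P : 'Hom(W, V)) :
  P \in Hom_rep ResW V -> vee P \in Hom_rep W (Ind V).
Proof.
move=> hP; apply/Hom_repP => g gG w; apply/val_inj/ffunP => x /=.
rewrite ind_actE !veeE // -[rep_act W x^-1%g _]comp_lfunE -rep_actM ?inE //.
by rewrite invMg invgK.
Qed.

Lemma vee_eq0 (P : 'Hom(W, V)) : P \in Hom_rep ResW V -> vee P = 0 -> P = 0.
Proof.
move=> hP P0; apply/lfunP => w; have := veeE w 1%g hP.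
rewrite P0 invg1 rep_act1 !lfunE /= ffunE => /esym/eqP.
by rewrite scaler_eq0 invr_eq0 sqrtC_eq0 pnatr_eq0 eqn0Ngt indexg_gt0 => /eqP.
Qed.

Definition ind_eval1 (f : subvs_of (ind_space V)) : V := vsval f 1%g.

Fact ind_eval1_linear : linear ind_eval1.
Proof. by move=> a f h; rewrite /ind_eval1 linearP !ffunE. Qed.

HB.instance Definition _ :=
  GRing.isLinear.Build _ _ _ _ _ ind_eval1_linear.

(** Evaluation at 1 inverts [vee] on K-intertwiners up to the factor sqrt([G : K]). *)
Definition unvee (T : 'Hom(W, Ind V)) : 'Hom(ResW, V) :=
  (linfun ind_eval1 \o T)%VF.

Lemma unveeE (T : 'Hom(W, Ind V)) w :
  unvee T w = vsval (T w : subvs_of (ind_space V)) 1%g.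
Proof. by rewrite comp_lfunE lfunE. Qed.

Lemma unvee_Hom_rep (T : 'Hom(W, Ind V)) :
  T \in Hom_rep W (Ind V) -> unvee T \in Hom_rep ResW V.
Proof.
move=> /Hom_repP hT; apply/Hom_repP => k kK w.
rewrite !unveeE hT ?inE // ind_actE mulg1 -[k^-1%g]mul1g.
have /ind_spaceP -> := subvsP (T w : subvs_of (ind_space V)).
  by rewrite invgK.
by rewrite groupV.
Qed.

(** By equivariance (T w)(g) is the value at 1 of T (sigma(g^-1) w). *)
Lemma unvee_eq0 (T : 'Hom(W, Ind V)) :
  T \in Hom_rep W (Ind V) -> unvee T = 0 -> T = 0.
Proof.
move=> /Hom_repP hT T0; apply/lfunP => w; apply/val_inj/ffunP => g.
have : unvee T (rep_act W g^-1%g w) = 0 by rewrite T0 lfunE.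
by rewrite unveeE hT ?inE // ind_actE invgK mulg1 lfunE /= ffunE.
Qed.

(* Both injections below are conjugate-linear, hence conj_linear_dim_leq.     *)
Lemma dim_Hom_rep_Ind : \dim (Hom_rep W (Ind V)) = \dim (Hom_rep V ResW).
Proof.
apply/eqP; rewrite eqn_leq; apply/andP; split.
  apply: (conj_linear_dim_leq (phi := fun T => adjoint (unvee T))).
  - by move=> a S T; rewrite -adjoint_conj_linear /unvee comp_lfunDr comp_lfunZr.
  - by move=> T hT; apply/adjoint_Hom_rep/unvee_Hom_rep.
  - by move=> T hT /adjoint_eq0; apply: unvee_eq0.
apply: (conj_linear_dim_leq (phi := fun T : 'Hom(V, ResW) => vee (adjoint T))).
- by move=> a S T; rewrite adjoint_conj_linear vee_linear.
- by move=> T hT; apply/vee_Hom_rep/adjoint_Hom_rep.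
- by move=> T hT /vee_eq0 T0; apply/adjoint_eq0/T0/adjoint_Hom_rep.
Qed.

Lemma vee_dot (P Q : 'Hom(W, V)) w1 w2 :
  P \in Hom_rep ResW V -> Q \in Hom_rep ResW V ->
  rep_dot (Ind V) (vee P w1) (vee Q w2) =
  #|[set: gT]|%:R^-1 *
    \sum_(g in [set: gT]) rep_dot V (P (rep_act W g w1)) (Q (rep_act W g w2)).
Proof.
move=> hP hQ; rewrite /= /ind_dot.
(* The factor 1/|K| of [ind_dot] and the 1/[G : K] from the two square roots combine to 1/|G|. *)
rewrite -(LagrangeI [set: gT] K) setTI natrM invfM -mulrA; congr (_ * _).
rewrite mulr_sumr (reindex_inj invg_inj) /=.
apply: eq_big => [g|g _]; first by rewrite inE.
rewrite !veeE // invgK linearZl_LR linearZr_LR /= mulrA; congr (_ * _).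
rewrite fmorphV /= conj_Creal ?ger0_real ?sqrtC_ge0 ?ler0n //.
by rewrite -invfM -expr2 sqrtCK.
Qed.

Lemma vee_adjoint_dot (L M : 'Hom(V, ResW)) w1 w2 mu :
  irreducible_rep W -> L \in Hom_rep V ResW -> M \in Hom_rep V ResW ->
  (adjoint L \o M)%VF = mu *: \1%VF ->
  rep_dot (Ind V) (vee (adjoint L) w1) (vee (adjoint M) w2) =
  (\dim {: V})%:R / (\dim {: W})%:R * mu * rep_dot W w1 w2.
Proof.
move=> irrW /adjoint_Hom_rep hL /adjoint_Hom_rep hM Emu; rewrite vee_dot //.
rewrite (eq_bigr (fun g => rep_dot W ((M \o adjoint L)%VF (rep_act W g w1))
                                     (rep_act W g w2))); last first.
  by move=> g _; rewrite comp_lfunE -(adjointP M).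
(* Cyclicity moves the trace from [W] to [V], where [Emu] makes it mu d_theta. *)
rewrite sum_rep_dot_schur // -[lftrace _]lftrace_comp Emu lftraceZ lftrace_id.
by rewrite -[mu * _ / _]mulrA [mu * _]mulrC.
Qed.

End Frobenius.
End Representations.

Theorem corollary3p5 (R : realType) (gT : finGroupType) (K : {group gT})
    (W : unitary_rep R[i] [set: gT]) (V : unitary_rep R[i] K)
    (irrW : irreducible_rep W) (irrV : irreducible_rep V)
    (m : nat) (hm : m = \dim (Hom_rep W (Ind V)))
    (L : 'I_m -> 'Hom(V, Res (subsetT K) W))
    (hL : forall i, L i \in Hom_rep V (Res (subsetT K) W)) :
  isometric_orthogonal_decomposition
    (fun i => sqrtC ((\dim {: W})%:R / (\dim {: V})%:R) *: vee (adjoint (L i)))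
  <-> isometric_orthogonal_decomposition L.
Proof.
set c := sqrtC _.
have [W0 V0] : (0 < \dim {: W})%N /\ (0 < \dim {: V})%N.
  by case: irrW; case: irrV.
have cc : c * c^* = (\dim {: W})%:R / (\dim {: V})%:R.
  rewrite conj_Creal ?ger0_real ?sqrtC_ge0 ?divr_ge0 ?ler0n //.
  by rewrite -expr2 sqrtCK.
have /choice[mu muP] ij : exists a, (adjoint (L ij.1) \o L ij.2)%VF = a *: \1%VF.
  by apply: schur irrV _; apply: comp_Hom_rep; first apply: adjoint_Hom_rep.
have vee_mu i j w1 w2 : rep_dot (Ind V) ((c *: vee (adjoint (L i))) w1)
    ((c *: vee (adjoint (L j))) w2) = mu (i, j) * rep_dot W w1 w2.
  rewrite !scale_lfunE linearZl_LR linearZr_LR /= mulrA cc.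
  rewrite (vee_adjoint_dot _ _ irrW (hL i) (hL j) (muP (i, j))).
  rewrite -[_ * mu _ * _]mulrA [LHS]mulrA -[X in X * _ * _]invf_div mulVf ?mul1r //.
  by rewrite mulf_neq0 ?invr_eq0 // pnatr_eq0 -lt0n.
have L_mu i j v1 v2 : rep_dot W (L i v1) (L j v2) = (mu (i, j))^* * rep_dot V v1 v2.
  rewrite (adjointP (L i)) -comp_lfunE (muP (i, j)).
  by rewrite !lfun_simp linearZr_LR.
split=> [[_ _ orth] | [_ _ orth]]; split=> //.
- by rewrite hm dim_Hom_rep_Ind.
- move=> i j v1 v2; rewrite L_mu [RHS]mulrC.
  (* Since [W] is nonzero, orthonormality of the vees forces [mu (i, j)] to be the delta. *)
  rewrite (rep_dot_scale_inj (x := mu (i, j)) (y := (i == j)%:R) W0) ?conjC_nat //.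
  by move=> w1 w2; rewrite -vee_mu orth mulrC.
- by move=> i; apply/rpredZ/vee_Hom_rep/adjoint_Hom_rep.
- move=> i j w1 w2; rewrite vee_mu [RHS]mulrC; congr (_ * _).
  (* The hypothesis on [L] determines the conjugate of [mu (i, j)], so both sides are conjugated
     first. *)
  rewrite -[mu _]conjCK -[RHS]conjC_nat; congr (_ ^*).
  by apply: (rep_dot_scale_inj V0) => v1 v2; rewrite -L_mu orth mulrC.
Qed.
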